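(* If $H$ is a connected graph such that $H\prec G$ for every cubic graph $G$ with a perfect matching, then either $H\simeq S_{10}$ or $H\simeq S_{12}$.
   Context: Graphs are finite, undirected and loopless, but may contain parallel edges (both $H$ and the cubic graphs $G$); $\simeq$ denotes isomorphism of (multi)graphs. For a vertex $u$ of a graph $G$, $\partial_G u$ denotes the set of edges of $G$ incident to $u$. An $H$-colouring of $G$ is a map $f:E(G)\to E(H)$ that is a proper edge-colouring (adjacent edges of $G$ receive distinct edges of $H$) such that for every $u\in V(G)$ there exists $v\in V(H)$ with $f(\partial_G u)=\partial_H v$. We write $H\prec G$ ($H$ colours $G$) if $G$ admits an $H$-colouring. $S_{10}$ (the Sylvester graph) is the cubic multigraph on the ten vertices $z$ and $u^i,v^i,w^i$ ($i\in\{1,2,3\}$) whose edges are, for each $i\in\{1,2,3\}$: two parallel edges between $v^i$ and $w^i$, one edge $u^iv^i$, one edge $u^iw^i$, and one edge $u^iz$. $S_{12}$ is the cubic multigraph on the twelve vertices $z^i,u^i,v^i,w^i$ ($i\in\{1,2,3\}$) whose edges are: for each $i\in\{1,2,3\}$, two parallel edges between $v^i$ and $w^i$, one edge $u^iv^i$, one edge $u^iw^i$, one edge $u^iz^i$; together with the three edges $z^1z^2$, $z^2z^3$, $z^1z^3$. *)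

(* Defs.v *)
From mathcomp Require Import all_boot.

Set Implicit Arguments.
Unset Strict Implicit.
Unset Printing Implicit Defensive.

(* Finite undirected multigraphs without loops: an edge is a name together with
   its two-element set of ends, so parallel edges are distinct names with the
   same set of ends. *)
Record mgraph := MGraph {
  vertex : finType;
  edge : finType;
  ends : edge -> {set vertex};
  card_ends : forall e, #|ends e| = 2
}.

Section Basics.
Variable G : mgraph.
Implicit Types (x y u : vertex G) (e : edge G) (M : {set edge G}).

Definition star u : {set edge G} := [set e | u \in ends e].

Definition edge_adj e1 e2 : bool :=
  (e1 != e2) && (ends e1 :&: ends e2 != set0).

Definition vertex_adj x y : bool := [exists e, ends e == [set x; y]].

Definition connected : Prop :=
  0 < #|vertex G| /\ forall x y, connect vertex_adj x y.

Definition cubic : Prop := forall u, #|star u| = 3.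

Definition matching M : Prop := {in M &, forall e1 e2, ~~ edge_adj e1 e2}.

Definition perfect_matching M : Prop :=
  matching M /\ forall u, exists2 e, e \in M & u \in ends e.

End Basics.

Definition coloring (H G : mgraph) (f : edge G -> edge H) : Prop :=
  (forall e1 e2, edge_adj e1 e2 -> f e1 != f e2) /\
  (forall u : vertex G, exists v : vertex H, f @: star u = star v).

Definition colors (H G : mgraph) : Prop :=
  exists f : edge G -> edge H, coloring f.

Definition isomorphic (G1 G2 : mgraph) : Prop :=
  exists (phi : vertex G1 -> vertex G2) (psi : edge G1 -> edge G2),
    [/\ bijective phi, bijective psi & forall e, ends (psi e) = phi @: ends e].

(* The superscript i in {1,2,3} is represented by i : 'I_3. *)

(* Sylvester graph: vertices None = z, Some (i, 0) = u^i, Some (i, 1) = v^i and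
   Some (i, 2) = w^i; five edges for each i. *)
Definition S10_vertex : finType := option ('I_3 * 'I_3).
Definition S10_edge : finType := ('I_3 * 'I_5)%type.

Definition S10_z : S10_vertex := None.
Definition S10_u (i : 'I_3) : S10_vertex := Some (i, @Ordinal 3 0 isT).
Definition S10_v (i : 'I_3) : S10_vertex := Some (i, @Ordinal 3 1 isT).
Definition S10_w (i : 'I_3) : S10_vertex := Some (i, @Ordinal 3 2 isT).

Definition S10_ends (e : S10_edge) : {set S10_vertex} :=
  let: (i, k) := e in
  match val k with
  | 0 | 1 => [set S10_v i; S10_w i]
  | 2 => [set S10_u i; S10_v i]
  | 3 => [set S10_u i; S10_w i]
  | _ => [set S10_u i; S10_z]
  end.

Lemma S10_card_ends e : #|S10_ends e| = 2.
Proof.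
by case: e => i [[|[|[|[|[|k]]]]] Hk] //=; rewrite cards2 // (inj_eq Some_inj) xpair_eqE andbF.
Qed.

Definition S10 : mgraph := MGraph S10_card_ends.

(* Vertices (i, 0) = u^i, (i, 1) = v^i, (i, 2) = w^i, (i, 3) = z^i; six edges
   for each i, where the last one joins z^i to z^(i+1), superscripts being taken
   cyclically, so that these three edges form the triangle z^1 z^2 z^3. *)
Definition S12_vertex : finType := ('I_3 * 'I_4)%type.
Definition S12_edge : finType := ('I_3 * 'I_6)%type.

Definition S12_u (i : 'I_3) : S12_vertex := (i, @Ordinal 4 0 isT).
Definition S12_v (i : 'I_3) : S12_vertex := (i, @Ordinal 4 1 isT).
Definition S12_w (i : 'I_3) : S12_vertex := (i, @Ordinal 4 2 isT).
Definition S12_z (i : 'I_3) : S12_vertex := (i, @Ordinal 4 3 isT).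

Definition S12_ends (e : S12_edge) : {set S12_vertex} :=
  let: (i, k) := e in
  match val k with
  | 0 | 1 => [set S12_v i; S12_w i]
  | 2 => [set S12_u i; S12_v i]
  | 3 => [set S12_u i; S12_w i]
  | 4 => [set S12_u i; S12_z i]
  | _ => [set S12_z i; S12_z (ordS i)]
  end.

Lemma S12_card_ends e : #|S12_ends e| = 2.
Proof.
case: e => i [[|[|[|[|[|[|k]]]]]] Hk] //=; rewrite cards2 xpair_eqE ?andbF //.
by case: i => [[|[|[|i]]] Hi].
Qed.

Definition S12 : mgraph := MGraph S12_card_ends.

(* Main.v *)
Require Import Defs.
From mathcomp Require Import all_boot.

Set Implicit Arguments.
Unset Strict Implicit.
Unset Printing Implicit Defensive.

(* S12 has a perfect matching, so it has an H-colouring.  Each of its three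
   pendant blocks (a triangle u v w with vw doubled) is mapped faithfully onto
   such a block of H, and the edge leaving one image at its degree-two corner
   (the stem) is not an edge of another image; doubled edges are what makes the
   pieces recognisable.  The proper colouring of the central triangle then forces
   the three images to be disjoint, and sends the triangle's vertices either to a
   triangle of H or all to the same vertex.  Every vertex in
   the image has its whole star in the image, so by connectedness the image is
   all of H, which is S12 in the first case and S10 in the second. *)

(** * Parallel edges, and a criterion for isomorphism *)

Section MultigraphTheory.
Variable G : mgraph.
Implicit Types (x y z : vertex G) (e : edge G).

Lemma ends_eq x y e : x \in ends e -> y \in ends e -> x != y ->
  ends e = [set x; y].
Proof.
move=> xe ye xy; apply/esym/eqP; rewrite eqEcard card_ends cards2 xy /= andbT.
by apply/subsetP=> z; rewrite !inE => /orP[]/eqP->.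
Qed.

Definition digon e : bool := [exists e', (e' != e) && (ends e' == ends e)].

Lemma digonI e e' : e' != e -> ends e' = ends e -> digon e.
Proof. by move=> ne ee; apply/existsP; exists e'; rewrite ne ee eqxx. Qed.

Lemma digonP e : reflect (exists2 e', e' != e & ends e' = ends e) (digon e).
Proof.
apply: (iffP existsP) => [[e' /andP[ne /eqP ee]]|[e' ne ee]]; exists e' => //.
by rewrite ne ee eqxx.
Qed.

End MultigraphTheory.

Lemma isomorphic_sym G1 G2 : isomorphic G1 G2 -> isomorphic G2 G1.
Proof.
case=> phi [psi [[phi' phiK phi'K] [psi' psiK psi'K] hom]].
exists phi', psi'; split; [by exists phi | by exists psi |] => e.
rewrite -{2}[e]psi'K hom -imset_comp.
by rewrite (eq_imset _ (g := id)) ?imset_id.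
Qed.

(** Each [f e] lies in the stars of the images of both ends of [e], so counting gives
    [ends (f e) = g @: ends e], and injectivity of [f] on stars becomes global. Connectedness of [H]
    gives surjectivity. *)
Lemma inj_coloring_isomorphic (G H : mgraph) (g : vertex G -> vertex H)
    (f : edge G -> edge H) (x0 : vertex G) :
  connected H -> injective g ->
  (forall x, star (g x) = f @: star x /\ {in star x &, injective f}) ->
  isomorphic G H.
Proof.
move=> [_ Hconn] g_inj /all_and2[g_star f_inj].
have hom e : ends (f e) = g @: ends e.
  apply/esym/eqP; rewrite eqEcard card_imset // !card_ends leqnn andbT.
  apply/subsetP=> _ /imsetP[x xe ->].
  have : f e \in star (g x) by rewrite g_star imset_f // inE.
  by rewrite inE.
have f_injT : injective f.
  move=> e e' ff.
  have ee : ends e = ends e' by apply: (imset_inj g_inj); rewrite -!hom ff.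
  have [x xe] : exists x, x \in ends e by apply/card_gt0P; rewrite card_ends.
  by apply: (f_inj x); rewrite ?inE // -ee.
have g_surj y : y \in codom g.
  have : y \in connect (@vertex_adj H) (g x0) by exact: Hconn.
  suff cl : fingraph.closed (@vertex_adj H) (mem (codom g)).
    by move/(closed_connect cl) <-; rewrite codom_f.
  apply: intro_closed => [|x z /existsP[e /eqP ee] /codomP[x' ex]].
    apply: sym_connect_sym => x z.
    by apply/existsP/existsP => -[e]; rewrite setUC; exists e.
  (* An edge at an image vertex is itself an [f]-image, so its other end is an image vertex too. *)
  have : e \in star (g x') by rewrite inE ee -ex !inE eqxx.
  rewrite g_star => /imsetP[e' _ def_e].
  have : z \in ends e by rewrite ee !inE eqxx orbT.
  by rewrite def_e hom => /imsetP[z' _ ->]; exact: codom_f.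
have f_surj e : e \in codom f.
  have [y ye] : exists y, y \in ends e by apply/card_gt0P; rewrite card_ends.
  have /codomP[x def_y] := g_surj y.
  have : e \in star (g x) by rewrite inE -def_y.
  by rewrite g_star => /imsetP[e' _ ->]; exact: codom_f.
exists g, f; split=> //.
  exists (fun y => iinv (g_surj y)) => [x|y]; last exact: f_iinv.
  by apply: g_inj; rewrite f_iinv.
exists (fun e => iinv (f_surj e)) => [e|e]; last exact: f_iinv.
by apply: f_injT; rewrite f_iinv.
Qed.

(** Produces the star hypothesis of [inj_coloring_isomorphic] from explicit listings. *)
Lemma star_seq_coloring (G H : mgraph) (f : edge G -> edge H) x y s :
  star x =i s -> star y =i map f s -> uniq (map f s) ->
  star y = f @: star x /\ {in star x &, injective f}.
Proof.
move=> xs ys us; split.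
  apply/setP=> e; rewrite ys; apply/mapP/imsetP => -[e' e's ->]; exists e' => //.
    by rewrite xs.
  by rewrite -xs.
apply/dinjectiveP; rewrite /dinjectiveb.
rewrite (perm_uniq (perm_map f (_ : perm_eq _ s))) //.
apply: uniq_perm; rewrite ?enum_uniq ?(map_uniq us) // => e.
by rewrite mem_enum.
Qed.

(** * Pendant blocks and how two of them can meet *)

Section Blocks.
Variable H : mgraph.
Implicit Types (u v w z : vertex H) (b c d p q e : edge H).

(** A triangle with sides [c] (from [u] to [v]) and [d] (from [u] to [w]), doubled edge [p], [q],
    and stem [b] at [u]. It is stated through stars alone, since these are what a colouring
    transports; [block_ends] recovers the ends. *)
Record block u v w b c d p q : Prop := Block {
  star_u : star u =i [:: b; c; d];
  star_v : star v =i [:: p; q; c];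
  star_w : star w =i [:: p; q; d];
  uniq_u : uniq [:: b; c; d];
  uniq_v : uniq [:: p; q; c];
  uniq_w : uniq [:: p; q; d]
}.

Lemma block_swap u v w b c d p q :
  block u v w b c d p q -> block u w v b d c p q.
Proof.
case=> su sv sw uu uv uw; split=> //.
  by move=> e; rewrite su !inE [(e == d) || _]orbC.
by move: uu; rewrite /= !inE [d == c]eq_sym !negb_or => /and3P[/andP[-> ->] ->].
Qed.

Section OneBlock.
Variables (u v w : vertex H) (b c d p q : edge H).
Hypothesis B : block u v w b c d p q.

Lemma in_u e : (u \in ends e) = [|| e == b, e == c | e == d].
Proof. by have := star_u B e; rewrite !inE. Qed.

Lemma in_v e : (v \in ends e) = [|| e == p, e == q | e == c].
Proof. by have := star_v B e; rewrite !inE. Qed.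

Lemma in_w e : (w \in ends e) = [|| e == p, e == q | e == d].
Proof. by have := star_w B e; rewrite !inE. Qed.

Lemma block_neqs :
  [/\ b != c, b != d & c != d] /\ [/\ p != q, p != c, q != c, p != d & q != d].
Proof.
move: (uniq_u B) (uniq_v B) (uniq_w B); rewrite /= !inE !negb_or -!andbA.
by move=> /and4P[-> -> -> _] /and4P[-> -> -> _] /and4P[_ -> -> _].
Qed.

Lemma block_vertices : [/\ u != v, u != w & v != w].
Proof.
have [[_ _ cd] [_ pc qc pd qd]] := block_neqs.
have ud : u \in ends d by rewrite in_u eqxx !orbT.
have uc : u \in ends c by rewrite in_u eqxx !orbT.
have wd : w \in ends d by rewrite in_w eqxx !orbT.
split; apply/eqP=> E.
- by move: ud; rewrite E in_v !(eq_sym d) (negPf pd) (negPf qd) (negPf cd).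
- by move: uc; rewrite E in_w !(eq_sym c) (negPf pc) (negPf qc) eq_sym (negPf cd).
by move: wd; rewrite -E in_v !(eq_sym d) (negPf pd) (negPf qd) (negPf cd).
Qed.

Lemma block_ends :
  [/\ ends c = [set u; v], ends d = [set u; w],
      ends p = [set v; w] & ends q = [set v; w]].
Proof.
have [uv uw vw] := block_vertices.
by split; apply: ends_eq => //; rewrite (in_u, in_v, in_w) eqxx ?orbT.
Qed.

Lemma block_digon : digon p /\ digon q.
Proof.
have [_ [pq _ _ _ _]] := block_neqs; have [_ _ ep eq] := block_ends.
by split; [apply: (@digonI _ _ q) | apply: (@digonI _ _ p)];
   rewrite ?ep ?eq // eq_sym.
Qed.

(** A parallel copy of [c] would lie at [v], hence be [p] or [q], and these miss [u]. *)
Lemma block_c_not_digon : ~~ digon c.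
Proof.
have [uv uw _] := block_vertices; have [ec _ ep eq] := block_ends.
apply/digonP=> -[e /negPf ne ee].
have : u \in ends e by rewrite ee ec !inE eqxx.
have : v \in ends e by rewrite ee ec !inE eqxx orbT.
rewrite in_v ne orbF => /orP[]/eqP->.
  by rewrite ep !inE (negPf uv) (negPf uw).
by rewrite eq !inE (negPf uv) (negPf uw).
Qed.

End OneBlock.

Section OneBlockContinued.
Variables (u v w : vertex H) (b c d p q : edge H).
Hypothesis B : block u v w b c d p q.

Lemma block_d_not_digon : ~~ digon d.
Proof. exact: block_c_not_digon (block_swap B). Qed.

Lemma block_b_not_digon : ~~ digon b.
Proof.
apply/digonP=> -[e ne ee].
have dge : digon e by apply: (@digonI _ _ b); rewrite // eq_sym.
have : u \in ends e by rewrite ee (in_u B) eqxx.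
rewrite (in_u B) (negPf ne) /=.
by case/orP=> /eqP def_e; move: dge;
   rewrite def_e (negPf (block_c_not_digon B), negPf block_d_not_digon).
Qed.

Lemma block_u_not_digon e : u \in ends e -> ~~ digon e.
Proof.
rewrite (in_u B) => /or3P[]/eqP->.
- exact: block_b_not_digon.
- exact: block_c_not_digon B.
exact: block_d_not_digon.
Qed.

End OneBlockContinued.

Section TwoBlocks.
Variables (u v w : vertex H) (b c d p q : edge H).
Hypothesis B : block u v w b c d p q.

(** If [b] were [c'], the blocks would share [u], and following the second triangle from [u] along
    [d'] identifies it with the first. Then [c'] is a side of the first block, not its stem. *)
Lemma block_stem_neq_c u' v' w' b' c' d' p' q' :
  block u' v' w' b' c' d' p' q' -> b != c'.
Proof.
move=> B'; apply/eqP=> bc'.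
have [[_ _ cd'] _] := block_neqs B'.
have [dp' dq'] := block_digon B'; have [ec' ed' ep' eq'] := block_ends B'.
have uu' : u = u'.
  have : u \in ends c' by rewrite -bc' (in_u B) eqxx.
  rewrite ec' !inE => /orP[]/eqP // uv'.
  have /(block_u_not_digon B) : u \in ends p' by rewrite uv' (in_v B') eqxx.
  by rewrite dp'.
have [uw' vw'] : u != w' /\ v' != w'.
  by have [_] := block_vertices B'; rewrite uu'.
(* Stated for any labelling of the first block, so that it serves [d' = c] and, after swapping,
   [d' = d]. *)
have absurd V W C D P Q : block u V W b C D P Q -> d' = C -> False.
  move=> B1 dC; have [[bC bD CD] _] := block_neqs B1.
  have [eC eD eP eQ] := block_ends B1; have [dP _] := block_digon B1.
  have wV : w' = V.
    have : w' \in ends C by rewrite -dC ed' !inE eqxx orbT.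
    by rewrite eC !inE eq_sym (negPf uw') => /eqP.
  have WV : W != w'.
    by have [_ _] := block_vertices B1; rewrite wV eq_sym.
  (* [P] is doubled and [d'] is not, so at [w'] it is [p'] or [q'], whose other end is [v']. *)
  have Wv : W = v'.
    have : w' \in ends P by rewrite wV (in_v B1) eqxx.
    have : W \in ends P by rewrite eP !inE eqxx orbT.
    rewrite (in_w B') => WP /or3P[]/eqP E; move: WP dP.
    - by rewrite E ep' !inE (negPf WV) orbF => /eqP.
    - by rewrite E eq' !inE (negPf WV) orbF => /eqP.
    by rewrite E (negPf (block_d_not_digon B')).
  have : v' \in ends D by rewrite -Wv eD !inE eqxx orbT.
  rewrite (in_v B') => /or3P[]/eqP E.
  - by have := block_d_not_digon B1; rewrite E dp'.
  - by have := block_d_not_digon B1; rewrite E dq'.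
  by rewrite bc' E eqxx in bD.
have : u \in ends d' by rewrite ed' uu' !inE eqxx.
rewrite (in_u B) bc' eq_sym (negPf cd') /= => /orP[]/eqP.
  exact: absurd B.
exact: absurd (block_swap B).
Qed.

Lemma block_stem_notin u' v' w' b' c' d' p' q' :
  block u' v' w' b' c' d' p' q' -> b \notin [:: c'; d'; p'; q'].
Proof.
move=> B'; have [dp' dq'] := block_digon B'.
rewrite !inE (negPf (block_stem_neq_c B')).
rewrite (negPf (block_stem_neq_c (block_swap B'))) /=.
by apply/orP=> -[]/eqP E; have := block_b_not_digon B; rewrite E ?dp' ?dq'.
Qed.

Lemma block_stem_at_u u' v' w' b' c' d' p' q' :
  block u' v' w' b' c' d' p' q' -> u' \in ends b -> b = b'.
Proof.
move=> B'; have := block_stem_notin B'; rewrite (in_u B') !inE.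
by do 2![case: eqP => //= _]; rewrite orbF => _ /eqP.
Qed.

Lemma block_stem_at_v u' v' w' b' c' d' p' q' :
  block u' v' w' b' c' d' p' q' -> v' \notin ends b.
Proof.
move=> B'; have := block_stem_notin B'; rewrite (in_v B') !inE.
by do 4![case: eqP => //= _].
Qed.

Lemma block_stem_at_w u' v' w' b' c' d' p' q' :
  block u' v' w' b' c' d' p' q' -> w' \notin ends b.
Proof. by move/block_swap/block_stem_at_v. Qed.

(** An edge at [u'] other than its stem is [c'] or [d'], and the far end, [v'] or [w'], is avoided
    by every stem. *)
Lemma block_stem_near u' v' w' b' c' d' p' q' e z :
  block u' v' w' b' c' d' p' q' -> u' \in ends e -> e != b' ->
  z \in ends e -> z \in ends b -> z = u'.
Proof.
move=> B'; have [ec ed _ _] := block_ends B'.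
have [nv nw] := (block_stem_at_v B', block_stem_at_w B').
rewrite (in_u B') => /or3P[]/eqP-> nb; first by rewrite eqxx in nb.
  by rewrite ec !inE => /orP[]/eqP-> //; rewrite (negPf nv).
by rewrite ed !inE => /orP[]/eqP-> //; rewrite (negPf nw).
Qed.

(** The only undoubled edge at [v] is [c], so the blocks share this edge and with it its other
    end. *)
Lemma block_eq_v u' v' w' b' c' d' p' q' :
  block u' v' w' b' c' d' p' q' -> v = v' -> u = u'.
Proof.
move=> B' vv'; have [dp' dq'] := block_digon B'.
have [uv _ _] := block_vertices B; have [ec' _ _ _] := block_ends B'.
have : v' \in ends c by rewrite -vv' (in_v B) eqxx !orbT.
have nc := block_c_not_digon B.
rewrite (in_v B') => /or3P[]/eqP E; try by move: nc; rewrite E ?dp' ?dq'.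
have : u \in ends c by rewrite (in_u B) eqxx !orbT.
by rewrite E ec' !inE -vv' (negPf uv) orbF => /eqP.
Qed.

End TwoBlocks.
End Blocks.

(** * Three blocks whose stems end on a properly coloured triangle *)

Section ThreeBlocks.
Variable H : mgraph.
Variables (U V W Z : 'I_3 -> vertex H) (b c d p q m : 'I_3 -> edge H).
Hypothesis B : forall i, block (U i) (V i) (W i) (b i) (c i) (d i) (p i) (q i).
(** [m i] stands for the image of the edge from [z^i] to [z^(i+1)]; in ['I_3], [ordS (ordS i)] is
    the predecessor of [i]. *)
Hypothesis starZ : forall i, star (Z i) =i [:: b i; m i; m (ordS (ordS i))].
Hypothesis uniqZ : forall i, uniq [:: b i; m i; m (ordS (ordS i))].

Lemma ordS3K (i : 'I_3) : ordS (ordS (ordS i)) = i.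
Proof. by apply/val_inj; case: i => [[|[|[|i]]] Hi]. Qed.

Lemma ordS3_neq (i j : 'I_3) : i != j -> j = ordS i \/ i = ordS j.
Proof.
case: i j => [[|[|[|i]]] Hi] [[|[|[|j]]] Hj] //= _;
  by [left; apply/val_inj | right; apply/val_inj].
Qed.

Lemma in_Z i e :
  (Z i \in ends e) = [|| e == b i, e == m i | e == m (ordS (ordS i))].
Proof. by have := starZ i e; rewrite !inE. Qed.

Lemma Z_neqs i :
  [/\ b i != m i, b i != m (ordS (ordS i)) & m i != m (ordS (ordS i))].
Proof. by move: (uniqZ i); rewrite /= !inE negb_or => /and3P[/andP[-> ->] ->]. Qed.

(** If [Z i = U i], then [m i] is a side of block [i], whose far end no stem reaches, so for
    [j = ordS i] both [Z j = Z i] and [b j = b i]. This makes [m j] a fourth edge at [Z i]. *)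
Lemma Z_neq_own_U i : Z i != U i.
Proof.
apply/eqP=> ZU; set j := ordS i; set k := ordS j.
have kK : ordS k = i by exact: ordS3K.
have [bm bk _] := Z_neqs i.
have [bmj _ mji] := Z_neqs j; have [_ bmk mkj] := Z_neqs k.
rewrite -/j -/k kK -/j in bk bmj bmk mji mkj.
have near l e : e != b i -> Z i \in ends e -> Z l \in ends e ->
    Z l = Z i /\ b l = b i.
  move=> nb ie le; have lb : Z l \in ends (b l) by rewrite in_Z eqxx.
  have lU : Z l = U i by apply: (block_stem_near (B l) (B i) _ nb le lb); rewrite -ZU.
  by split; [rewrite lU | apply: (block_stem_at_u (B l) (B i)); rewrite -lU].
have [ZjZi bji] : Z j = Z i /\ b j = b i.
  by apply: (near j (m i)); rewrite 1?eq_sym // in_Z -/j -/k ?kK eqxx ?orbT.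
have [_ bki] : Z k = Z i /\ b k = b i.
  by apply: (near k (m k)); rewrite 1?eq_sym // in_Z -/j -/k ?kK eqxx ?orbT.
(* [m j] differs from [b i = b j] and [m i] by distinctness at [Z j], and from [m k] by distinctness
   at [Z k]. *)
have : Z j \in ends (m j) by rewrite in_Z eqxx orbT.
rewrite ZjZi in_Z -/j -/k -bji eq_sym (negPf bmj) /=.
by rewrite (negPf mji) eq_sym (negPf mkj).
Qed.

Lemma ends_stem i : ends (b i) = [set U i; Z i].
Proof.
by apply: ends_eq; rewrite ?(in_u (B i)) ?in_Z ?eqxx // eq_sym Z_neq_own_U.
Qed.

(** If [b i = b j] with [j = ordS i], then [Z j] is an end of [b i]. The end [Z i] would again carry
    a fourth edge [m j]; the end [U i] makes [m i] a side of block [i], which meets [b i] only at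
    [U i], so that [Z i = U i]. *)
Lemma stem_inj : injective b.
Proof.
suff bS i : b i != b (ordS i).
  move=> i j bij; apply/eqP/negP=> /negP/ordS3_neq[] E.
    by have := bS i; rewrite -E bij eqxx.
  by have := bS j; rewrite -E bij eqxx.
apply/eqP=> bij; set j := ordS i in bij; set k := ordS j.
have kK : ordS k = i by exact: ordS3K.
have [bm _ _] := Z_neqs i.
have [_ _ mkj] := Z_neqs k; have [_ _ mji] := Z_neqs j.
rewrite -/j -/k kK -/j in mkj mji.
have ZjU : Z j = U i.
  have : Z j \in ends (b i) by rewrite bij in_Z eqxx.
  rewrite ends_stem !inE => /orP[/eqP//|/eqP ZZ].
  have : Z j \in ends (m j) by rewrite in_Z eqxx orbT.
  rewrite ZZ in_Z -/j -/k bij eq_sym.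
  by have [/negPf-> _ _] := Z_neqs j; rewrite (negPf mji) eq_sym (negPf mkj).
have nb : m i != b i by rewrite eq_sym.
have Zim : Z i \in ends (m i) by rewrite in_Z eqxx orbT.
have Zjm : U i \in ends (m i) by rewrite -ZjU in_Z -/j -/k kK eqxx !orbT.
have Zib : Z i \in ends (b i) by rewrite in_Z eqxx.
by have := Z_neq_own_U i; rewrite (block_stem_near (B i) (B i) Zjm nb Zim Zib) eqxx.
Qed.

(** A stem at the corner of another block is that block's stem, so equal corners give equal
    stems. *)
Lemma U_inj : injective U.
Proof.
move=> i j Uij; apply: stem_inj; apply: (block_stem_at_u (B i) (B j)).
by rewrite -Uij ends_stem !inE eqxx.
Qed.

Lemma V_inj : injective V.
Proof. by move=> i j Vij; apply: U_inj; apply: (block_eq_v (B i) (B j)). Qed.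

Lemma W_inj : injective W.
Proof.
by move=> i j Wij; apply: U_inj;
   apply: (block_eq_v (block_swap (B i)) (block_swap (B j))).
Qed.

(** [U i] lies on the stem [b i], which avoids [V j]; the same argument serves [W j], and [Z i] in
    place of [U i]. *)
Lemma U_neq_V i j : U i != V j.
Proof.
apply: contraNneq (block_stem_at_v (B i) (B j)) => <-.
by rewrite ends_stem !inE eqxx.
Qed.

Lemma U_neq_W i j : U i != W j.
Proof.
apply: contraNneq (block_stem_at_w (B i) (B j)) => <-.
by rewrite ends_stem !inE eqxx.
Qed.

Lemma V_neq_W i j : V i != W j.
Proof.
apply/eqP=> E; have /U_inj ij := block_eq_v (B i) (block_swap (B j)) E.
by have [_ _] := block_vertices (B i); rewrite E ij eqxx.
Qed.

Lemma Z_neq_V i j : Z i != V j.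
Proof.
apply: contraNneq (block_stem_at_v (B i) (B j)) => <-.
by rewrite ends_stem !inE eqxx orbT.
Qed.

Lemma Z_neq_W i j : Z i != W j.
Proof.
apply: contraNneq (block_stem_at_w (B i) (B j)) => <-.
by rewrite ends_stem !inE eqxx orbT.
Qed.

Lemma Z_neq_U i j : Z i != U j.
Proof.
apply/eqP=> E; have [ij|] := eqVneq i j.
  by have := Z_neq_own_U j; rewrite -E ij eqxx.
case/eqP; apply: stem_inj; apply: (block_stem_at_u (B i) (B j)).
by rewrite -E ends_stem !inE eqxx orbT.
Qed.

(** With [j = ordS i], the stem [b i] lies at [Z j] but is neither [b j] nor [m i], so it is [m j].
    The third vertex [Z k] lies on [m j], hence is an end of [b i], and only [Z i] is possible. *)
Lemma Z_collapse i : Z i = Z (ordS i) ->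
  b i = m (ordS i) /\ Z i = Z (ordS (ordS i)).
Proof.
set j := ordS i; set k := ordS j => ZZ.
have kK : ordS k = i by exact: ordS3K.
have [bm _ _] := Z_neqs i.
have bmj : b i = m j.
  have : Z i \in ends (b i) by rewrite in_Z eqxx.
  rewrite ZZ in_Z -/j -/k kK (inj_eq stem_inj) (negPf bm) orbF => /orP[]/eqP //.
  by rewrite /j; case: (i) => [[|[|[|l]]] Hl] // /(congr1 val).
split=> //; have : Z k \in ends (m j) by rewrite in_Z -/j kK -/j eqxx !orbT.
by rewrite -bmj ends_stem !inE (negPf (Z_neq_U _ _)) => /eqP.
Qed.

(** Two distinct indices modulo 3 are consecutive in one order or the other, so any coincidence
    triggers [Z_collapse]. *)
Lemma Z_const i j : i != j -> Z i = Z j -> forall k l, Z k = Z l.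
Proof.
suff ZS n : Z n = Z (ordS n) -> forall k, Z k = Z n.
  move=> /ordS3_neq[]-> ZZ k l.
    by rewrite (ZS i) // (ZS i _ l).
  by rewrite (ZS j) // (ZS j _ l).
move=> E k; have [_ E'] := Z_collapse E.
have [-> //|/ordS3_neq[->|k_def]] := eqVneq n k.
  by rewrite -E.
by rewrite E' k_def ordS3K.
Qed.

(** Packed as a rewrite rule for all vertex comparisons except [Z i == Z j], on which the two
    outcomes differ. *)
Lemma vertex_eqs :
  ((forall i j, (U i == U j) = (i == j)) * (forall i j, (V i == V j) = (i == j)) *
   (forall i j, (W i == W j) = (i == j)) * (forall i j, (U i == V j) = false) *
   (forall i j, (V i == U j) = false) * (forall i j, (U i == W j) = false) *
   (forall i j, (W i == U j) = false) * (forall i j, (V i == W j) = false) *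
   (forall i j, (W i == V j) = false) * (forall i j, (Z i == U j) = false) *
   (forall i j, (U i == Z j) = false) * (forall i j, (Z i == V j) = false) *
   (forall i j, (V i == Z j) = false) * (forall i j, (Z i == W j) = false) *
   (forall i j, (W i == Z j) = false))%type.
Proof.
pose neqs := (U_neq_V, U_neq_W, V_neq_W, Z_neq_U, Z_neq_V, Z_neq_W).
do ![split]; try exact/inj_eq/U_inj; try exact/inj_eq/V_inj;
  try exact/inj_eq/W_inj;
  by move=> i j; apply: negbTE; rewrite ?neqs // eq_sym
    ?neqs.
Qed.

End ThreeBlocks.

(** * The graph [S12]: stars, cubicity and a perfect matching *)

Local Notation o k := (@Ordinal 6 k isT).

Lemma star_S12_u i : @star S12 (S12_u i) =i [:: (i, o 4); (i, o 2); (i, o 3)].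
Proof.
by case: i => [[|[|[|i]]] Hi] // [[[|[|[|j]]] Hj] [[|[|[|[|[|[|k]]]]]] Hk]] //;
   rewrite !inE.
Qed.

Lemma star_S12_v i : @star S12 (S12_v i) =i [:: (i, o 0); (i, o 1); (i, o 2)].
Proof.
by case: i => [[|[|[|i]]] Hi] // [[[|[|[|j]]] Hj] [[|[|[|[|[|[|k]]]]]] Hk]] //;
   rewrite !inE.
Qed.

Lemma star_S12_w i : @star S12 (S12_w i) =i [:: (i, o 0); (i, o 1); (i, o 3)].
Proof.
by case: i => [[|[|[|i]]] Hi] // [[[|[|[|j]]] Hj] [[|[|[|[|[|[|k]]]]]] Hk]] //;
   rewrite !inE.
Qed.

Lemma star_S12_z i :
  @star S12 (S12_z i) =i [:: (i, o 4); (i, o 5); (ordS (ordS i), o 5)].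
Proof.
by case: i => [[|[|[|i]]] Hi] // [[[|[|[|j]]] Hj] [[|[|[|[|[|[|k]]]]]] Hk]] //;
   rewrite !inE.
Qed.

Lemma S12_vertexP (P : vertex S12 -> Prop) :
  (forall i, P (S12_u i)) -> (forall i, P (S12_v i)) ->
  (forall i, P (S12_w i)) -> (forall i, P (S12_z i)) -> forall x, P x.
Proof.
move=> Pu Pv Pw Pz [i [[|[|[|[|k]]]] Hk]] //.
- by rewrite (_ : (i, _) = S12_u i) //; congr (_, _); apply: val_inj.
- by rewrite (_ : (i, _) = S12_v i) //; congr (_, _); apply: val_inj.
- by rewrite (_ : (i, _) = S12_w i) //; congr (_, _); apply: val_inj.
by rewrite (_ : (i, _) = S12_z i) //; congr (_, _); apply: val_inj.
Qed.

Lemma S12_cubic : cubic S12.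
Proof.
apply: S12_vertexP => i.
- by rewrite (eq_card (star_S12_u i)); apply: (card_uniqP _); rewrite /= !inE !xpair_eqE !andbF.
- by rewrite (eq_card (star_S12_v i)); apply: (card_uniqP _); rewrite /= !inE !xpair_eqE !andbF.
- by rewrite (eq_card (star_S12_w i)); apply: (card_uniqP _); rewrite /= !inE !xpair_eqE !andbF.
rewrite (eq_card (star_S12_z i)); apply: (card_uniqP _).
by case: i => [[|[|[|i]]] Hi].
Qed.

Lemma S12_perfect_matching : exists M : {set edge S12}, perfect_matching M.
Proof.
(* For each [i], one of the two parallel edges [v^i w^i], and the stem [u^i z^i]. *)
exists [set e : S12_edge | (val e.2 == 0) || (val e.2 == 4)]; split.
  move=> e1 e2 M1 M2; apply/negP=> /andP[/negP ne /set0Pn[x]].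
  rewrite inE => /andP[x1 x2]; apply: ne.
  have {x1}: e1 \in star x by rewrite inE.
  have {x2}: e2 \in star x by rewrite inE.
  move: M1 M2; rewrite 2!inE; move: x; apply: S12_vertexP => i.
  - by rewrite !star_S12_u !inE => M1 M2 /or3P[]/eqP E2 /or3P[]/eqP E1;
     move: M1 M2; rewrite E1 E2 ?eqxx.
  - by rewrite !star_S12_v !inE => M1 M2 /or3P[]/eqP E2 /or3P[]/eqP E1;
     move: M1 M2; rewrite E1 E2 ?eqxx.
  - by rewrite !star_S12_w !inE => M1 M2 /or3P[]/eqP E2 /or3P[]/eqP E1;
     move: M1 M2; rewrite E1 E2 ?eqxx.
  by rewrite !star_S12_z !inE => M1 M2 /or3P[]/eqP E2 /or3P[]/eqP E1;
     move: M1 M2; rewrite E1 E2 ?eqxx.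
apply: S12_vertexP => i.
- by exists (i, o 4); rewrite !inE ?eqxx.
- by exists (i, o 0); rewrite !inE ?eqxx.
- by exists (i, o 0); rewrite !inE ?eqxx ?orbT.
by exists (i, o 4); rewrite !inE ?eqxx ?orbT.
Qed.

(** * Colourings as maps of stars *)

Lemma coloring_star_inj (H G : mgraph) (f : edge G -> edge H) :
  coloring f -> forall x, {in star x &, injective f}.
Proof.
move=> [f_adj _] x e e'; rewrite !inE => xe xe' fe; apply/eqP/negP=> /negP ne.
have /f_adj/eqP[] // : edge_adj e e'.
by rewrite /edge_adj ne; apply/set0Pn; exists x; rewrite inE xe.
Qed.

(** A finite choice: distinct vertices of [H] may have the same star, so [f] need not determine
    [g]. *)
Lemma coloring_vertex_map (H G : mgraph) (f : edge G -> edge H) :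
  coloring f ->
  exists g : vertex G -> vertex H, forall x, star (g x) = f @: star x.
Proof.
case=> _ f_star.
by apply: (@fin_all_exists _ _ (fun x y => star y = f @: star x)) => x;
   have [y ey] := f_star x; exists y.
Qed.

Lemma coloring_star_seq (G H : mgraph) (f : edge G -> edge H)
    (g : vertex G -> vertex H) x (s : seq (edge G)) :
  coloring f -> (forall y, star (g y) = f @: star y) ->
  star x =i s -> #|star x| = size s ->
  star (g x) =i map f s /\ uniq (map f s).
Proof.
move=> f_col g_star xs cs; split.
  move=> e; rewrite g_star; apply/imsetP/mapP => -[e' e's ->]; exists e' => //.
    by rewrite -xs.
  by rewrite xs.
rewrite map_inj_in_uniq.
  by apply/card_uniqP; rewrite -cs; apply/esym/eq_card.
by move=> e e'; rewrite -!xs; apply: coloring_star_inj.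
Qed.

(** * The stars of [S10] *)

Lemma star_S10_u i : @star S10 (S10_u i) =i
  [:: (i, @Ordinal 5 4 isT); (i, @Ordinal 5 2 isT); (i, @Ordinal 5 3 isT)].
Proof.
by case: i => [[|[|[|i]]] Hi] // [[[|[|[|j]]] Hj] [[|[|[|[|[|k]]]]] Hk]] //;
   rewrite !inE.
Qed.

Lemma star_S10_v i : @star S10 (S10_v i) =i
  [:: (i, @Ordinal 5 0 isT); (i, @Ordinal 5 1 isT); (i, @Ordinal 5 2 isT)].
Proof.
by case: i => [[|[|[|i]]] Hi] // [[[|[|[|j]]] Hj] [[|[|[|[|[|k]]]]] Hk]] //;
   rewrite !inE.
Qed.

Lemma star_S10_w i : @star S10 (S10_w i) =i
  [:: (i, @Ordinal 5 0 isT); (i, @Ordinal 5 1 isT); (i, @Ordinal 5 3 isT)].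
Proof.
by case: i => [[|[|[|i]]] Hi] // [[[|[|[|j]]] Hj] [[|[|[|[|[|k]]]]] Hk]] //;
   rewrite !inE.
Qed.

(** The indices run backwards from [i] so that, once each stem [b j] equals [m (ordS j)], the
    listing maps to [b i], [m i], [m (ordS (ordS i))], the order used for the star of [Z i]. *)
Lemma star_S10_z i : @star S10 S10_z =i
  [seq (j, @Ordinal 5 4 isT) | j <- [:: i; ordS (ordS i); ordS i]].
Proof.
by case: i => [[|[|[|i]]] Hi] // [[[|[|[|j]]] Hj] [[|[|[|[|[|k]]]]] Hk]] //;
   rewrite !inE.
Qed.

Lemma S10_vertexP (P : vertex S10 -> Prop) :
  (forall i, P (S10_u i)) -> (forall i, P (S10_v i)) ->
  (forall i, P (S10_w i)) -> P S10_z -> forall x, P x.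
Proof.
move=> Pu Pv Pw Pz [[i [[|[|[|k]]] Hk]]|] //.
- by rewrite (_ : Some _ = S10_u i) //; congr (Some (_, _)); apply: val_inj.
- by rewrite (_ : Some _ = S10_v i) //; congr (Some (_, _)); apply: val_inj.
by rewrite (_ : Some _ = S10_w i) //; congr (Some (_, _)); apply: val_inj.
Qed.

(** * The image of [S12] in [H] and its two possible shapes *)

Section Image.
Variables (H : mgraph) (f : edge S12 -> edge H) (g : vertex S12 -> vertex H).
Hypothesis f_col : coloring f.
Hypothesis g_star : forall x, star (g x) = f @: star x.

Let U i := g (S12_u i).
Let V i := g (S12_v i).
Let W i := g (S12_w i).
Let Z i := g (S12_z i).
Let e k i := f (i, k).

Lemma image_block i : block (U i) (V i) (W i)
  (e (o 4) i) (e (o 2) i) (e (o 3) i) (e (o 0) i) (e (o 1) i).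
Proof.
have [su uu] := coloring_star_seq f_col g_star (star_S12_u i) (S12_cubic _).
have [sv uv] := coloring_star_seq f_col g_star (star_S12_v i) (S12_cubic _).
by have [sw uw] := coloring_star_seq f_col g_star (star_S12_w i) (S12_cubic _).
Qed.

Lemma image_z i : star (Z i) =i [:: e (o 4) i; e (o 5) i; e (o 5) (ordS (ordS i))]
  /\ uniq [:: e (o 4) i; e (o 5) i; e (o 5) (ordS (ordS i))].
Proof. exact: (coloring_star_seq f_col g_star (star_S12_z i) (S12_cubic _)). Qed.

Let B := image_block.
Let starZ i := (image_z i).1.
Let uniqZ i := (image_z i).2.

Let neqs := vertex_eqs B starZ uniqZ.

(** Here [g] and the colouring [f] themselves form the isomorphism. *)
Lemma image_S12 : connected H -> injective Z -> isomorphic S12 H.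
Proof.
move=> Hconn Z_inj; apply: (inj_coloring_isomorphic (S12_z ord0) Hconn (g := g) (f := f)).
  apply: S12_vertexP => i; apply: S12_vertexP => j /eqP;
  rewrite -?/(U _) -?/(V _) -?/(W _) -?/(Z _) ?neqs ?(inj_eq Z_inj) //;
  by move/eqP->.
by move=> x; split; [exact: g_star | exact: coloring_star_inj].
Qed.

(** Meant for the case where all [Z i] coincide; [Z ord0] is then an arbitrary representative. *)
Definition collapsed_vertex_map (x : vertex S10) : vertex H :=
  if x is Some (i, k) then
    match val k with 0 => U i | 1 => V i | _ => W i end
  else Z ord0.

Definition collapsed_edge_map (x : edge S10) : edge H :=
  let: (i, k) := x in
  match val k with
  | 0 => e (o 0) i | 1 => e (o 1) i | 2 => e (o 2) i | 3 => e (o 3) i | _ => e (o 4) i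
  end.

Lemma image_S10 : connected H -> (forall i j, Z i = Z j) -> isomorphic S10 H.
Proof.
move=> Hconn Zc.
(* Each triangle edge has the same image as the opposite stem, so dropping the triangle loses no
   edge of the image. *)
have stem_triangle i : e (o 4) i = e (o 5) (ordS i).
  by have [] := Z_collapse B starZ uniqZ (Zc i (ordS i)).
apply: (inj_coloring_isomorphic S10_z Hconn (g := collapsed_vertex_map)
  (f := collapsed_edge_map)).
  by apply: S10_vertexP => [i|i|i|]; apply: S10_vertexP => [j|j|j|] //= /eqP;
    rewrite ?neqs // => /eqP->.
apply: S10_vertexP => [i|i|i|].
- exact: star_seq_coloring (star_S10_u i) (star_u (B i)) (uniq_u (B i)).
- exact: star_seq_coloring (star_S10_v i) (star_v (B i)) (uniq_v (B i)).
- exact: star_seq_coloring (star_S10_w i) (star_w (B i)) (uniq_w (B i)).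
have mapE : map collapsed_edge_map
    [seq (j, @Ordinal 5 4 isT) | j <- [:: ord0; ordS (ordS ord0); ordS ord0]] =
    [:: e (o 4) ord0; e (o 5) ord0; e (o 5) (ordS (ordS ord0))].
  by rewrite /= !stem_triangle !ordS3K.
apply: star_seq_coloring (star_S10_z ord0) _ _; rewrite mapE.
  exact: starZ.
exact: uniqZ.
Qed.

Lemma image_isomorphic : connected H -> isomorphic S10 H \/ isomorphic S12 H.
Proof.
move=> Hconn; have [Zi|] := boolP (injectiveb Z).
  by right; apply: image_S12 => //; apply/injectiveP.
case/injectivePn=> i [j ij Zij]; left; apply: image_S10 => //.
exact: (Z_const B starZ uniqZ ij Zij).
Qed.

End Image.

Theorem corollary3p10 (H : mgraph) (Hconn : connected H)
  (Hcol : forall G : mgraph,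
     cubic G -> (exists M : {set edge G}, perfect_matching M) -> colors H G) :
  isomorphic H S10 \/ isomorphic H S12.
Proof.
have [f f_col] := Hcol S12 S12_cubic S12_perfect_matching.
have [g g_star] := coloring_vertex_map f_col.
by have [] := image_isomorphic f_col g_star Hconn; [left | right];
   apply: isomorphic_sym.
Qed.
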